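(* For all non-negative integers $n,k$, $$\mathscr{T}(n,k) = B_{n,k}(T_1, T_2, \ldots, T_n),$$ where $\mathscr{T}(n,k)$ are the higher-order tangent numbers, $T_n$ are the tangent numbers and $B_{n,k}$ are the (exponential) partial Bell polynomials.
   Context: For non-negative integers $n,k$, the $n$-th tangent number of order $k$ (higher-order tangent number) $\mathscr{T}(n,k)$ is defined by the power series expansion $\frac{\tan^{k}t}{k!} = \sum_{n=k}^{\infty}\mathscr{T}(n,k)\frac{t^n}{n!}$, with $\mathscr{T}(n,k)=0$ for $n<k$. The tangent numbers are $T_n := \mathscr{T}(n,1)$, i.e. $\tan t=\sum_{n\ge1}T_n\frac{t^n}{n!}$. The multivariate (exponential) partial Bell polynomials $B_{n,k}(x_1,\ldots,x_n)$ are defined by the formal power series expansion $\frac{1}{k!}\left(\sum_{m=1}^{\infty} x_m \frac{t^m}{m!}\right)^k = \sum_{n=k}^{\infty} B_{n,k}(x_1, x_2, \ldots, x_n)\frac{t^n}{n!}$, with $B_{n,k}=0$ for $n<k$. *)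

(* Defs.v *)
(* Tangent numbers: Stdlib reals and Coquelicot, so that [tan] is the genuine
   real function.  Bell polynomials: MathComp and multinomials ([{mpoly F[n]}]);
   [Rstruct] makes the Stdlib reals [R] an instance of [numFieldType].          *)
From Stdlib Require Import Reals Lra Lia.
From Coquelicot Require Import Coquelicot.

Local Open Scope R_scope.

(* tan^k t / k! = \sum_(n >= k) T n * t^n / n!  for all t near 0, with T n = 0
   for n < k. *)
Definition is_tangent_expansion (k : nat) (T : nat -> R) : Prop :=
  (forall n, (n < k)%nat -> T n = 0) /\
  locally 0 (fun t => is_pseries (fun n => T n / INR (Factorial.fact n)) t
                                 (tan t ^ k / INR (Factorial.fact k))).

Module TanSeries.

(* Auxiliary: Maclaurin coefficients of tan, from tan' = 1 + tan^2. *)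
Definition delta (n : nat) : R := match n with O => 1 | S _ => 0 end.

Definition step (p : nat -> R) (m : nat) : R :=
  match m with
  | O => 0
  | S m' => (delta m' + PS_mult p p m') / INR (S m')
  end.

Fixpoint approx (n : nat) : nat -> R :=
  match n with O => fun _ => 0 | S n' => step (approx n') end.

Definition coef (n : nat) : R := approx n n.

Lemma PS_mult_ext_le (a b a' b' : nat -> R) n :
  (forall i, (i <= n)%nat -> a i = a' i) ->
  (forall i, (i <= n)%nat -> b i = b' i) ->
  PS_mult a b n = PS_mult a' b' n.
Proof.
intros Ha Hb; unfold PS_mult; apply sum_eq; intros i Hi.
rewrite Ha, Hb; [easy | lia | lia].
Qed.

Lemma approx_stable n : forall n' m,
  (m <= n)%nat -> (m <= n')%nat -> approx n m = approx n' m.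
Proof.
induction n as [|n IH]; intros n' m H H'.
- replace m with 0%nat by lia; now destruct n'.
- destruct m as [|m]; [now destruct n'|].
  destruct n' as [|n']; [lia|]; simpl; unfold step.
  rewrite (PS_mult_ext_le _ _ (approx n') (approx n')); [easy | |];
    intros i Hi; apply IH; lia.
Qed.

Lemma coef0 : coef 0 = 0.
Proof. reflexivity. Qed.

Lemma coefS n : INR (S n) * coef (S n) = delta n + PS_mult coef coef n.
Proof.
change (coef (S n)) with ((delta n + PS_mult (approx n) (approx n) n) / INR (S n)).
rewrite (PS_mult_ext_le _ _ coef coef).
- unfold Rdiv; rewrite Rmult_comm, Rmult_assoc, Rinv_l, Rmult_1_r; [easy|].
  apply not_0_INR; lia.
- intros i Hi; apply approx_stable; lia.
- intros i Hi; apply approx_stable; lia.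
Qed.

Lemma sum_bound (u : nat -> R) n :
  (forall i, (i <= n)%nat -> Rabs (u i) <= 1) -> Rabs (sum_f_R0 u n) <= INR (S n).
Proof.
induction n as [|n IH]; intros H.
- simpl; apply (H 0%nat); lia.
- simpl sum_f_R0; rewrite S_INR.
  eapply Rle_trans; [apply Rabs_triang|].
  apply Rplus_le_compat; [apply IH; intros i Hi|]; apply H; lia.
Qed.

Lemma coef_bound n : Rabs (coef n) <= 1.
Proof.
induction n as [n IH] using (well_founded_induction Wf_nat.lt_wf).
destruct n as [|n]; [rewrite coef0, Rabs_R0; lra|].
assert (Hn : 0 < INR (S n)) by (apply lt_0_INR; lia).
apply (Rmult_le_reg_l (INR (S n))); [easy|].
rewrite <- (Rabs_pos_eq (INR (S n))) at 1; [|lra].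
rewrite <- Rabs_mult, coefS, Rmult_1_r.
destruct n as [|n].
- unfold PS_mult; simpl; rewrite coef0, Rmult_0_l, Rplus_0_r, Rabs_R1; lra.
- simpl delta; rewrite Rplus_0_l; apply sum_bound; intros i Hi.
  rewrite Rabs_mult, <- (Rmult_1_r 1).
  apply Rmult_le_compat; try apply Rabs_pos; apply IH; lia.
Qed.

Lemma coef_radius x : Rabs x < 1 -> Rbar_lt (Rabs x) (CV_radius coef).
Proof.
intros Hx; apply Rbar_lt_le_trans with 1; [easy|].
apply (proj1 (CV_radius_bounded coef)); exists 1; intros n.
rewrite pow1, Rmult_1_r; apply coef_bound.
Qed.

Lemma is_pseries_delta x : is_pseries delta x 1.
Proof.
unfold is_pseries, is_series.
apply filterlim_ext with (fun _ : nat => 1); [|apply filterlim_const].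
intros n; induction n as [|n IH].
- rewrite sum_O, pow_n_pow; unfold scal; simpl; unfold mult; simpl; ring.
- rewrite sum_Sn, <- IH, pow_n_pow; unfold scal, plus; simpl; unfold mult; simpl; ring.
Qed.

Lemma PSeries_coef_tan x : Rabs x < 1 -> PSeries coef x = tan x.
Proof.
intros Hx.
assert (D : forall y, Rabs y < 1 ->
  is_derive (fun z => atan (PSeries coef z) - z) y 0).
{ intros y Hy.
  assert (Dy : is_derive (PSeries coef) y (1 + PSeries coef y * PSeries coef y)).
  { replace (1 + _) with (PSeries (PS_derive coef) y).
    { now apply is_derive_PSeries, coef_radius. }
    rewrite (PSeries_ext _ (PS_plus delta (PS_mult coef coef))).
    2:{ intros n; unfold PS_derive; now rewrite coefS. }
    apply is_pseries_unique.
    apply (is_pseries_plus delta (PS_mult coef coef) y 1 (PSeries coef y * PSeries coef y)).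
    - apply is_pseries_delta.
    - pose proof (coef_radius y Hy).
      now apply is_pseries_mult; try apply PSeries_correct, CV_radius_inside. }
  replace 0 with ((1 + PSeries coef y * PSeries coef y)
                  * / (1 + (PSeries coef y)²) - 1).
  2:{ unfold Rsqr; field; nra. }
  apply (is_derive_minus (fun z => atan (PSeries coef z)) (fun z => z)).
  - apply (is_derive_comp atan (PSeries coef)); [|easy].
    apply is_derive_Reals; rewrite Rsqr_pow2; apply derivable_pt_lim_atan.
  - apply (is_derive_id (K := R_AbsRing)). }
assert (E : atan (PSeries coef x) - x = 0).
{ destruct (MVT_gen (fun z => atan (PSeries coef z) - z) 0 x (fun _ => 0))
    as [c [_ Hc]].
  - intros y Hy; apply D; revert Hx Hy.
    unfold Rmin, Rmax; destruct (Rle_dec 0 x); split_Rabs; lra.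
  - intros y Hy; apply derivable_continuous_pt; exists 0; apply is_derive_Reals, D; revert Hx Hy.
    unfold Rmin, Rmax; destruct (Rle_dec 0 x); split_Rabs; lra.
  - rewrite PSeries_0, coef0, atan_0 in Hc; lra. }
rewrite <- (tan_atan (PSeries coef x)); f_equal; lra.
Qed.

Fixpoint pow_coef (k : nat) : nat -> R :=
  match k with O => delta | S k' => PS_mult coef (pow_coef k') end.

Lemma radius_of_ex (c : nat -> R) :
  (forall x, Rabs x < 1 -> ex_pseries c x) -> Rbar_le 1 (CV_radius c).
Proof.
intros H; apply Rbar_not_lt_le; intros Hlt.
pose proof (CV_radius_ge_0 c) as H0.
destruct (CV_radius c) as [r| |] eqn:Er; simpl in *; try easy.
assert (Hx : Rabs ((r + 1) / 2) = (r + 1) / 2) by (apply Rabs_pos_eq; lra).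
apply (CV_disk_outside c ((r + 1) / 2)).
- rewrite Er, Hx; simpl; lra.
- apply is_lim_seq_ext with (fun n => scal (pow_n ((r + 1) / 2) n) (c n)).
  + intros n; rewrite pow_n_pow; unfold scal; simpl; unfold mult; simpl; ring.
  + apply (ex_series_lim_0 (fun n => scal (pow_n ((r + 1) / 2) n) (c n))).
    apply (H ((r + 1) / 2)); lra.
Qed.

Lemma is_pseries_pow_coef k x : Rabs x < 1 -> is_pseries (pow_coef k) x (tan x ^ k).
Proof.
revert x; induction k as [|k IH]; intros x Hx.
- apply is_pseries_delta.
- simpl; rewrite <- (PSeries_coef_tan x) at 1 by easy.
  pose proof (coef_radius x Hx) as Hr.
  apply is_pseries_mult; [now apply PSeries_correct, CV_radius_inside
    | now apply IH | easy |].
  apply Rbar_lt_le_trans with 1; [easy|].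
  apply radius_of_ex; intros y Hy; exists (tan y ^ k); now apply IH.
Qed.

Lemma pow_coef_small k : forall n, (n < k)%nat -> pow_coef k n = 0.
Proof.
induction k as [|k IH]; intros n Hn; [lia|].
simpl; unfold PS_mult; rewrite (sum_eq _ (fun _ => 0)).
- rewrite sum_cte; ring.
- intros [|i] Hi; [rewrite coef0; ring|].
  rewrite IH; [ring | lia].
Qed.

End TanSeries.

Lemma tangent_expansion_exists (k : nat) : {T : nat -> R | is_tangent_expansion k T}.
Proof.
exists (fun n => INR (Factorial.fact n) * (TanSeries.pow_coef k n / INR (Factorial.fact k))).
split.
- intros n Hn; rewrite TanSeries.pow_coef_small by easy; unfold Rdiv; ring.
- exists (mkposreal 1 Rlt_0_1); intros t Ht.
  assert (Ht1 : Rabs t < 1).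
  { revert Ht; unfold ball; simpl; unfold AbsRing_ball; simpl.
    unfold abs, minus, plus, opp; simpl; now rewrite Ropp_0, Rplus_0_r. }
  apply is_pseries_ext with
    (PS_scal (/ INR (Factorial.fact k)) (TanSeries.pow_coef k)).
  + intros n; unfold PS_scal, scal; simpl; unfold mult; simpl.
    field; split; apply INR_fact_neq_0.
  + replace (tan t ^ k / _) with (scal (/ INR (Factorial.fact k)) (tan t ^ k)).
    2:{ unfold scal; simpl; unfold mult; simpl; unfold Rdiv; ring. }
    apply (is_pseries_scal (/ INR (Factorial.fact k)) (TanSeries.pow_coef k) t (tan t ^ k));
      [apply Rmult_comm|].
    now apply TanSeries.is_pseries_pow_coef.
Qed.

Lemma is_tangent_expansion_unique (k : nat) (T T' : nat -> R) :
  is_tangent_expansion k T -> is_tangent_expansion k T' -> forall n, T n = T' n.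
Proof.
assert (rad : forall S, is_tangent_expansion k S ->
  Rbar_lt 0 (CV_radius (fun n => S n / INR (Factorial.fact n)))).
{ intros S [_ [e He]]; apply Rbar_not_le_lt; intros Hle.
  assert (He2 : Rabs (e / 2) = e / 2)
    by (apply Rabs_pos_eq; pose proof (cond_pos e); lra).
  set (c := fun n => S n / INR (Factorial.fact n)) in *.
  apply (CV_disk_outside c (e / 2)).
  - apply Rbar_le_lt_trans with 0; [easy|].
    rewrite He2; simpl; pose proof (cond_pos e); lra.
  - apply is_lim_seq_ext with (fun n => scal (pow_n (e / 2) n) (c n)).
    + intros n; rewrite pow_n_pow; unfold scal; simpl; unfold mult; simpl; ring.
    + apply (ex_series_lim_0 (fun n => scal (pow_n (e / 2) n) (c n))).
      eexists; apply He.
      unfold ball; simpl; unfold AbsRing_ball, abs, minus, plus, opp; simpl.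
      rewrite Ropp_0, Rplus_0_r, He2; pose proof (cond_pos e); lra. }
intros HT HT' n.
assert (E : T n / INR (Factorial.fact n) = T' n / INR (Factorial.fact n)).
{ apply (PSeries_ext_recip (fun n => T n / INR (Factorial.fact n))
                           (fun n => T' n / INR (Factorial.fact n)) n);
    [now apply rad | now apply rad |].
  destruct HT as [_ H], HT' as [_ H'].
  generalize (filter_and _ _ H H'); apply filter_imp; intros t [h h'].
  now rewrite (is_pseries_unique _ _ _ h), (is_pseries_unique _ _ _ h'). }
apply (Rmult_eq_reg_r (/ INR (Factorial.fact n))); [easy|].
apply Rinv_neq_0_compat, INR_fact_neq_0.
Qed.

(* The tangent number of order k; it is determined by its expansion, see
   [is_tangent_expansion_unique]. *)
Definition tangent (n k : nat) : R := proj1_sig (tangent_expansion_exists k) n.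

Lemma tangentP (k : nat) : is_tangent_expansion k (fun n => tangent n k).
Proof. exact (proj2_sig (tangent_expansion_exists k)). Qed.

From mathcomp Require Import all_boot all_order all_algebra.
From mathcomp Require Import Rstruct.
From mathcomp Require Import mpoly.

Import GRing.Theory Num.Theory.

Local Close Scope R_scope.
Local Open Scope ring_scope.

(* A formal power series is the sequence of its coefficients. *)
Definition fps_mul {A : comNzRingType} (f g : nat -> A) : nat -> A :=
  fun n => \sum_(i < n.+1) f i * g (n - i)%N.

Definition fps_exp {A : comNzRingType} (f : nat -> A) (k : nat) : nat -> A :=
  iter k (fps_mul f) (fun n => (n == 0%N)%:R).

(* [mpoly] numbers its variables from 0, so the x_m of the literature is
   ['X_(m - 1)].  In F[x_1, ..., x_n] the x_m with m > n are not available and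
   are set to 0; such an x_m occurs only in the coefficients of t^j, j >= m > n, of
   (\sum_(m >= 1) x_m t^m / m!)^k. *)
Definition bell_var (F : numFieldType) (n m : nat) : {mpoly F[n]} :=
  if m is m'.+1 then
    if insub m' is Some i then 'X_i else 0
  else 0.

Definition bell_series (F : numFieldType) (n : nat) : nat -> {mpoly F[n]} :=
  fun m => (m`!%:R)^-1 *: bell_var F n m.

(* B_{n,k} / n! is the coefficient of t^n in (\sum_(m >= 1) x_m t^m / m!)^k / k!. *)
Definition bell (F : numFieldType) (n k : nat) : {mpoly F[n]} :=
  (n`!%:R / k`!%:R) *: fps_exp (bell_series F n) k n.

Lemma bell_varE (F : numFieldType) (n : nat) (i : 'I_n) : bell_var F n i.+1 = 'X_i.
Proof. by rewrite /bell_var /= valK. Qed.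

Lemma fps_exp_morph (A B : comNzRingType) (phi : {rmorphism A -> B})
    (f : nat -> A) (g : nat -> B) (n k : nat) :
  (forall m, (m <= n)%N -> phi (f m) = g m) ->
  forall m, (m <= n)%N -> phi (fps_exp f k m) = fps_exp g k m.
Proof.
move=> fg; elim: k => [|k IHk] m le_mn; first by rewrite /fps_exp /= rmorph_nat.
rewrite /fps_exp /= /fps_mul rmorph_sum; apply: eq_bigr => i _.
have le_in : (i <= n)%N by apply: leq_trans le_mn; rewrite -ltnS.
rewrite rmorphM fg //; congr (_ * _); apply: IHk.
exact: leq_trans (leq_subr _ _) le_mn.
Qed.

(* The values of all the polynomials B_{n,k} fit in one generating series
   (with infinitely many x_m), so setting x_m to 0 for m > n was harmless. *)
Lemma bell_expansion (F : numFieldType) (x : nat -> F) (n k : nat) :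
  (k`!%:R)^-1 * fps_exp (fun m => if m is 0%N then 0 else x m / m`!%:R) k n =
  (bell F n k).@[fun i : 'I_n => x i.+1] / n`!%:R.
Proof.
have nf0 m : m`!%:R != 0 :> F by rewrite pnatr_eq0 -lt0n fact_gt0.
rewrite /bell mevalZ.
rewrite (fps_exp_morph _ _ (meval (fun i : 'I_n => x i.+1)) _
  (fun m => if m is 0%N then 0 else x m / m`!%:R) n k _ n) //.
  by rewrite mulrAC (mulrAC n`!%:R) divff // mul1r.
case=> [|m] lt_mn; first by rewrite /bell_series scaler0 rmorph0.
rewrite [LHS]mevalZ (bell_varE F n (Ordinal lt_mn)) mevalXU /=.
by rewrite mulrC.
Qed.

Lemma bell_small (F : numFieldType) (n k : nat) : (n < k)%N -> bell F n k = 0.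
Proof.
move=> lt_nk; rewrite /bell.
suff -> : fps_exp (bell_series F n) k n = 0 by rewrite scaler0.
suff H m : (m < k)%N -> fps_exp (bell_series F n) k m = 0 by exact: H.
elim: k m {lt_nk} => [//|k IHk] m lt_mk.
rewrite /fps_exp /= /fps_mul big1 // => -[[|i] lt_im] _ /=.
  by rewrite /bell_series /= scaler0 mul0r.
rewrite [X in _ * X]IHk ?mulr0 //.
case: m lt_mk lt_im => [|m] lt_mk lt_im //; rewrite subSS.
by apply: (@leq_ltn_trans m); rewrite ?leq_subr.
Qed.

(* Main.v *)
Require Import Defs.
From Stdlib Require Import Reals.
From Coquelicot Require Import Coquelicot.
From mathcomp Require Import all_boot all_order all_algebra.
From mathcomp Require Import Rstruct.
From mathcomp Require Import mpoly.

Import GRing.Theory Num.Theory.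

Local Open Scope ring_scope.

(** Both sides are the coefficient of [t^n / n!] in [tan t ^ k / k!].  On the left
    this is the analytic definition of the tangent numbers: by uniqueness of the
    expansion at 0, [tangent n k] is [n! / k!] times the coefficient of [t^n] in the
    [k]-th Cauchy power of the Maclaurin series of [tan] ([tangent_pow_coef]).  On the
    right this is the definition of the Bell polynomials: at [x_m = T_m] the series
    [\sum_(m >= 1) x_m t^m / m!] is the case [k = 1] of the same expansion, that is
    the Maclaurin series of [tan], so [bell_expansion] produces the same power. *)

(** The radius 1 is the one on which [TanSeries] sums the Maclaurin series of [tan]. *)
Lemma locally_Rabs_lt1 : locally R0 (fun t => Rlt (Rabs t) 1).
Proof.
exists (mkposreal 1 Rlt_0_1) => t.
rewrite /ball /= /AbsRing_ball /abs /minus /plus /Hierarchy.opp /=.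
by rewrite Ropp_0 Rplus_0_r.
Qed.

(** [tangent] is an opaque choice of expansion, so its values are accessible only
    through uniqueness; this exhibits the expansion to compare it with, the Cauchy
    powers of the Maclaurin series of [tan], summed for [|t| < 1]. *)
Lemma tangent_expansion_pow_coef (k : nat) :
  is_tangent_expansion k (fun n => n`!%:R * (TanSeries.pow_coef k n / k`!%:R)).
Proof.
have nf0 m : m`!%:R != 0 :> R by rewrite pnatr_eq0 -lt0n fact_gt0.
have factE m : INR (Factorial.fact m) = m`!%:R.
  by rewrite INRE; congr _%:R; elim: m => // m IHm; rewrite factS -IHm.
split=> [n /TanSeries.pow_coef_small ->|]; first by rewrite mul0r mulr0.
apply: filter_imp locally_Rabs_lt1 => t /(TanSeries.is_pseries_pow_coef k).
move=> /(is_pseries_scal (/ INR (Factorial.fact k))%R _ _ _ (Rmult_comm _ _)).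
have -> : scal (/ INR (Factorial.fact k))%R (pow (tan t) k)
          = (pow (tan t) k / INR (Factorial.fact k))%R by exact: Rmult_comm.
apply: is_pseries_ext => n.
rewrite /PS_scal /scal /= /mult /= !factE RmultE RinvE RdivE.
by rewrite [n`!%:R * _]mulrC mulfK // mulrC.
Qed.

Lemma tangent_pow_coef (n k : nat) :
  tangent n k = n`!%:R * (TanSeries.pow_coef k n / k`!%:R).
Proof.
exact: (is_tangent_expansion_unique k _ _ (tangentP k)
         (tangent_expansion_pow_coef k)).
Qed.

Lemma sum_f_R0_big_ord (F : nat -> R) (n : nat) :
  sum_f_R0 F n = \sum_(i < n.+1) F i.
Proof.
elim: n => [|n IHn]; first by rewrite big_ord1.
by rewrite big_ord_recr /= -IHn.
Qed.

Lemma PS_mult_fps_mul (f g : nat -> R) (n : nat) : PS_mult f g n = fps_mul f g n.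
Proof. exact: sum_f_R0_big_ord. Qed.

(** Powers of real power series and powers of formal ones are the same iterated
    Cauchy product. The base is only required to agree pointwise with [coef]: the
    series fed to the Bell polynomials is defined by cases on its index. *)
Lemma pow_coef_fps_exp (f : nat -> R) (k n : nat) :
  f =1 TanSeries.coef -> TanSeries.pow_coef k n = fps_exp f k n.
Proof.
move=> fE; elim: k n => [|k IHk] n; first by case: n.
rewrite /= PS_mult_fps_mul.
by apply: eq_bigr => i _; rewrite fE IHk.
Qed.

Lemma tangent1_coef (n : nat) : tangent n 1 = n`!%:R * TanSeries.coef n.
Proof.
rewrite tangent_pow_coef divr1 /= PS_mult_fps_mul /fps_mul big_ord_recr /=.
(* The first power is [coef] times the unit series, so only [i = n] contributes. *)
rewrite subnn mulr1 big1 ?add0r // => i _.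
by case: (n - i)%N (subn_gt0 i n) => [|m _]; rewrite ?ltn_ord // mulr0.
Qed.

Theorem proposition4 (n k : nat) :
  tangent n k = (bell R n k).@[fun i : 'I_n => tangent i.+1 1].
Proof.
have nf0 m : m`!%:R != 0 :> R by rewrite pnatr_eq0 -lt0n fact_gt0.
apply: (mulIf (invr_neq0 (nf0 n))).
rewrite -(bell_expansion R (tangent^~ 1%N)).
(* The Bell series has constant term 0, as has [coef] because [tan 0 = 0]; the
   other terms agree by the case [k = 1]. *)
rewrite -pow_coef_fps_exp => [|[|m]]; last 2 first.
- by rewrite TanSeries.coef0.
- by rewrite tangent1_coef mulrC mulKf.
by rewrite tangent_pow_coef mulrC mulKf // mulrC.
Qed.
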